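(* Let $(X_n,d_n)_{n\ge0}$ be a sequence of metric spaces such that $X_k\subset X_n$ and $d_n$ restricts to $d_k$ on $X_k$ for all $k\le n$. Assume that $X_0$ consists of a single point $x_0$. Assume that there exist maps $p_n:X_n\to X_{n-1}$ ($n\ge1$) satisfying (i) there exists $K\in\mathbb{N}$ such that for all $n$ and all $x_n\in X_n$ we have $d_n(p_n(x_n),x_n)\le K$; (ii) $d_{n-1}(p_n(x_n),p_n(y_n))\le d_n(x_n,y_n)$ for all $x_n,y_n\in X_n$ and all $n$. Let $\omega$ be a non-principal ultrafilter on $\mathbb{N}$. Then $\mathrm{Cone}_\omega(X_n,d_n)$ is contractible.
   Context: Asymptotic cone of a sequence of metric spaces, with scaling sequence $s_n=n$ and basepoint $x_0\in X_0\subset X_n$: a sequence $(x_n)_{n\ge1}$ with $x_n\in X_n$ is admissible if $d_n(x_n,x_0)/n$ is bounded. $\mathrm{Cone}_\omega(X_n,d_n)$ is the metric space of admissible sequences modulo $(x_n)\sim(y_n)$ iff $\lim_\omega d_n(x_n,y_n)/n=0$, with metric $\lim_\omega d_n(x_n,y_n)/n$. *)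

(* Defs.v *)
From HB Require Import structures.
From mathcomp Require Import all_boot all_order all_algebra generic_quotient.
From mathcomp Require Import boolp classical_sets functions filter reals.
From mathcomp Require Import topology normedtype.

Set Implicit Arguments.
Unset Strict Implicit.
Unset Printing Implicit Defensive.

Import Order.TTheory GRing.Theory Num.Theory.
Import numFieldNormedType.Exports.

Local Open Scope classical_set_scope.
Local Open Scope ring_scope.
Local Open Scope quotient_scope.

(* [d] is a metric on the subset [A]; its values outside [A] are irrelevant.
   As in the library factory [isMetric], nonnegativity is a consequence. *)
Record metric_on (R : realType) (T : Type) (A : set T) (d : T -> T -> R) :
    Prop := MetricOn {
  metric_on_xx : forall x, A x -> d x x = 0;
  metric_on_pos : forall x y, A x -> A y -> d x y = 0 -> x = y;
  metric_on_sym : forall x y, A x -> A y -> d x y = d y x;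
  metric_on_triangle : forall y x z, A x -> A y -> A z ->
    d x z <= d x y + d y z }.

Definition metric_subspace (R : realType) (T : Type) (A : set T)
  (d : T -> T -> R) (dA : metric_on A d) : Type := set_type A.

Section metric_subspace.
Context (R : realType) (T : Type) (A : set T) (d : T -> T -> R).
Variable dA : metric_on A d.
Local Notation S := (metric_subspace dA).

Definition subspace_val (x : S) : T := sval x.

Definition subspace_pt (x : T) (Ax : A x) : S := exist _ x (mem_set Ax).

Lemma subspace_valP (x : S) : A (subspace_val x).
Proof. exact: set_mem (svalP x). Qed.

Lemma subspace_val_inj : injective subspace_val.
Proof.
move=> [x Ax] [y Ay]; rewrite /subspace_val/= => xy; subst y.
by rewrite (Prop_irrelevance Ax Ay).
Qed.

Let dist (x y : S) : R := d (subspace_val x) (subspace_val y).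

Let distxx x : dist x x = 0.
Proof. exact: metric_on_xx dA _ (subspace_valP x). Qed.

Let dist_pos x y : dist x y = 0 -> x = y.
Proof.
move=> xy; apply: subspace_val_inj.
exact: metric_on_pos dA _ _ (subspace_valP x) (subspace_valP y) xy.
Qed.

Let dist_sym x y : dist x y = dist y x.
Proof. exact: metric_on_sym dA _ _ (subspace_valP x) (subspace_valP y). Qed.

Let dist_triangle y x z : dist x z <= dist x y + dist y z.
Proof.
by apply: (metric_on_triangle dA); exact: subspace_valP.
Qed.

HB.instance Definition _ := gen_eqMixin S.
HB.instance Definition _ := gen_choiceMixin S.
HB.instance Definition _ :=
  isMetric.Build R S distxx dist_pos dist_sym dist_triangle.

Lemma subspace_mdistE (x y : S) :
  mdist x y = d (subspace_val x) (subspace_val y).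
Proof. by []. Qed.

End metric_subspace.

Lemma nested_point (T : Type) (X : nat -> set T) (x0 : T) :
  (forall k n : nat, (k <= n)%N -> X k `<=` X n) -> X 0%N = [set x0] ->
  forall n, X n x0.
Proof. by move=> sX X0 n; apply: (sX 0%N) => //; rewrite X0. Qed.

Lemma ultra_fmap (S T : Type) (f : S -> T) (F : set_system S) :
  UltraFilter F -> UltraFilter (f @ F).
Proof.
move=> FU; split; first exact: fmap_proper_filter.
move=> G GP FG; apply/seteqP; split=> // A GA.
have [//|FA] := in_ultra_setVsetC (f @^-1` A) FU.
have GAC : G (~` A) by exact: FG.
by case: (filter_not_empty G); rewrite -(setICr A); exact: filterI.
Qed.

Lemma ultra_bounded_cvg (R : realType) (omega : set_system nat)
    (u : nat -> R) (a b : R) :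
  UltraFilter omega -> (forall n, a <= u n <= b) -> cvg (u @ omega).
Proof.
move=> oU uab; have /= := @segment_compact R a b.
rewrite compact_ultra => /(_ (u @ omega) (ultra_fmap u oU)).
case=> [|l [_ ul]]; last by apply/cvg_ex; exists l.
by apply: (@filterE _ omega) => n; rewrite /= in_itv/= uab.
Qed.

(* Sequences are taken over n >= 0, but the term of index 0 is immaterial:
   it is not constrained here, and it contributes [_ / 0%:R = 0] at a single
   index to limits along an ultrafilter, which is to be non-principal. *)
Record admissible_seq (R : realType) (X : nat -> metricType R)
    (x0 : forall n, X n) := AdmissibleSeq {
  seq_of : forall n, X n;
  seq_of_bounded :
    exists M : R, forall n, (0 < n)%N -> mdist (seq_of n) (x0 n) / n%:R <= M }.
Arguments seq_of {R X x0}.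

Section asymptotic_cone.
Context (R : realType) (X : nat -> metricType R) (x0 : forall n, X n).
Context (omega : set_system nat) (omegaU : UltraFilter omega).
Local Notation adm := (admissible_seq x0).

HB.instance Definition _ := gen_eqMixin adm.
HB.instance Definition _ := gen_choiceMixin adm.

Definition scaled_dist (x y : adm) (n : nat) : R :=
  mdist (seq_of x n) (seq_of y n) / n%:R.

Definition cone_pdist (x y : adm) : R := lim (scaled_dist x y @ omega).

Lemma cvg_scaled_dist x y : cvg (scaled_dist x y @ omega).
Proof.
have [[M xM] [N yN]] := (seq_of_bounded x, seq_of_bounded y).
apply: (@ultra_bounded_cvg _ _ _ 0 (`|M| + `|N|)) => // n.
rewrite /scaled_dist divr_ge0 ?mdist_ge0//=.
have [->|n0] := posnP n; first by rewrite invr0 mulr0 addr_ge0.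
apply: (@le_trans _ _ (M + N)); last by rewrite lerD// ler_norm.
apply: le_trans (lerD (xM _ n0) (yN _ n0)).
rewrite -mulrDl ler_wpM2r ?invr_ge0//.
by rewrite (metric_sym (seq_of y n)) metric_triangle.
Qed.

Lemma cone_pdistxx x : cone_pdist x x = 0.
Proof.
rewrite /cone_pdist (_ : scaled_dist x x = cst 0) ?lim_cst//.
by apply/funext => n; rewrite /scaled_dist mdistxx mul0r.
Qed.

Lemma cone_pdist_sym x y : cone_pdist x y = cone_pdist y x.
Proof.
rewrite /cone_pdist (_ : scaled_dist x y = scaled_dist y x)//.
by apply/funext => n; rewrite /scaled_dist metric_sym.
Qed.

Lemma cone_pdist_triangle y x z :
  cone_pdist x z <= cone_pdist x y + cone_pdist y z.
Proof.
have cxy := @cvg_scaled_dist x y; have cyz := @cvg_scaled_dist y z.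
rewrite /cone_pdist -limD//.
apply: ler_lim; [exact: cvg_scaled_dist|exact: is_cvgD|].
apply: filterE => n /=; rewrite /scaled_dist -mulrDl.
by rewrite ler_wpM2r ?invr_ge0// metric_triangle.
Qed.

Lemma cone_pdist_ge0 x y : 0 <= cone_pdist x y.
Proof.
apply: limr_ge; first exact: cvg_scaled_dist.
by apply: filterE => n; rewrite /scaled_dist divr_ge0// mdist_ge0.
Qed.

Definition cone_eq (x y : adm) : bool := `[< cone_pdist x y = 0 >].

Let cone_eq_refl : reflexive cone_eq.
Proof. by move=> x; apply/asboolP; exact: cone_pdistxx. Qed.

Let cone_eq_sym : symmetric cone_eq.
Proof. by move=> x y; rewrite /cone_eq cone_pdist_sym. Qed.

Let cone_eq_trans : transitive cone_eq.
Proof.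
move=> y x z /asboolP xy /asboolP yz; apply/asboolP/le_anti.
rewrite cone_pdist_ge0 andbT (le_trans (cone_pdist_triangle y _ _))//.
by rewrite xy yz addr0.
Qed.

Canonical cone_eq_canonical :=
  EquivRel cone_eq cone_eq_refl cone_eq_sym cone_eq_trans.

Definition cone : Type := {eq_quot cone_eq}.
HB.instance Definition _ := Choice.on cone.
HB.instance Definition _ := EqQuotient.on cone.

Let cone_dist (x y : cone) : R := cone_pdist (repr x) (repr y).

Let cone_distE (x y : adm) :
  cone_dist (\pi_cone x) (\pi_cone y) = cone_pdist x y.
Proof.
have reprE z : cone_pdist (repr (\pi_cone z)) z = 0.
  by apply/asboolP; rewrite -[asbool _]/(cone_eq _ _) -eqmodE reprK.
have le0 (x1 x2 y1 y2 : adm) : cone_pdist x1 x2 = 0 -> cone_pdist y1 y2 = 0 ->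
    cone_pdist x1 y1 <= cone_pdist x2 y2.
  move=> x12 y12; rewrite (le_trans (cone_pdist_triangle x2 _ _))// x12 add0r.
  rewrite (le_trans (cone_pdist_triangle y2 _ _))//.
  by rewrite (cone_pdist_sym y2) y12 addr0.
by apply/le_anti; rewrite !le0// cone_pdist_sym.
Qed.

Let cone_distxx x : cone_dist x x = 0.
Proof. exact: cone_pdistxx. Qed.

Let cone_dist_pos x y : cone_dist x y = 0 -> x = y.
Proof.
move=> xy; rewrite -[x]reprK -[y]reprK; apply/eqmodP/asboolP.
exact: xy.
Qed.

Let cone_dist_sym x y : cone_dist x y = cone_dist y x.
Proof. exact: cone_pdist_sym. Qed.

Let cone_dist_triangle y x z : cone_dist x z <= cone_dist x y + cone_dist y z.
Proof. exact: cone_pdist_triangle. Qed.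

HB.instance Definition _ := isMetric.Build R cone
  cone_distxx cone_dist_pos cone_dist_sym cone_dist_triangle.

Lemma cone_mdistE (x y : adm) :
  mdist (\pi_cone x) (\pi_cone y) = lim (scaled_dist x y @ omega).
Proof. exact: cone_distE. Qed.

End asymptotic_cone.

Definition homotopic (R : realType) (S T : topologicalType) (f g : S -> T) :
    Prop :=
  exists H : R * S -> T,
    [/\ {within `[0, 1] `*` [set: S], continuous H},
        forall x, H (0, x) = f x & forall x, H (1, x) = g x].

Definition contractible (R : realType) (T : topologicalType) : Prop :=
  exists c : T, homotopic R (@id T) (cst c).

(* Main.v *)
(** The iterates of the maps [p n] move a point of [X n] down to [x0] in [n]
    steps of length at most [K], so every sequence is admissible. Contract the
    cone by letting time [t] act on the [n]-th term as [t n] such steps: steps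
    do not increase distances, so after rescaling by [n] the result is
    [K]-Lipschitz in [t] and [1]-Lipschitz in the point, hence well defined on
    the cone and jointly continuous. *)
Require Import Defs.
From mathcomp Require Import all_boot all_order all_algebra generic_quotient.
From mathcomp Require Import boolp classical_sets functions filter reals.
From mathcomp Require Import topology normedtype sequences.
From mathcomp Require Import ring lra.

Set Implicit Arguments.
Unset Strict Implicit.
Unset Printing Implicit Defensive.

Import Order.TTheory GRing.Theory Num.Theory.
Import numFieldNormedType.Exports.

Local Open Scope classical_set_scope.
Local Open Scope ring_scope.
Local Open Scope quotient_scope.

(** * Limits along the ultrafilter and rounding *)

(** An ultrafilter containing a singleton is principal. So [F] contains the complement of every
    singleton, and finite intersections of these give all tails. *)
Lemma nonprincipal_ultra_cvg_infty (F : set_system nat) : UltraFilter F ->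
  (forall m, F <> principal_filter m) -> F --> \oo.
Proof.
move=> FU Fnp.
have Fne m : F (~` [set m]).
  have [Fm|//] := in_ultra_setVsetC [set m] FU.
  exfalso; apply: (Fnp m); apply/seteqP; split => A; rewrite principal_filterP.
    by move=> FA; have [n [/= -> //]] := filter_ex (filterI Fm FA).
  by move=> Am; apply: filterS Fm => n ->.
have Fge N : F [set n | (N <= n)%N].
  elim: N => [|N IHN]; first exact: filterE.
  apply: filterS (filterI IHN (Fne N)) => n /= [Nn nN].
  by rewrite ltn_neqAle Nn andbT; apply/eqP => Nn'; exact: nN.
by move=> A [N _ NA]; exact: filterS (Fge N).
Qed.

(** [Num.truncn] is the floor of the positive part, and taking positive parts does not increase
    distances. Negative reals are covered because the time parameter will range over all of [R]. *)
Lemma distr_truncn_le (R : archiRealFieldType) (a b : R) :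
  `|(Num.truncn a)%:R - (Num.truncn b)%:R| <= `|a - b| + 1 :> R.
Proof.
wlog ab : a b / a <= b => [th|].
  have [/th //|/ltW/th] := leP a b.
  by rewrite distrC [`|b - a|]distrC.
have tab : (Num.truncn a)%:R <= (Num.truncn b)%:R :> R.
  by rewrite ler_nat le_truncn.
rewrite ler0_norm ?ler0_norm ?subr_le0//.
have a_lt := truncnS_gt a; rewrite -natr1 in a_lt.
have [b0|b0] := leP 0 b.
  have := truncn_le b; rewrite b0 => b_ge; lra.
have /eqP -> : Num.truncn b == 0%N.
  by apply/eqP/truncn0Pn; rewrite -ltNge (lt_trans b0).
have : 0 <= (Num.truncn a)%:R :> R by [].
lra.
Qed.

(** * Distance estimates passing to the cone *)

Section cone_estimates.
Context (R : realType) (X : nat -> metricType R) (x0 : forall n, X n).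

Lemma seq_of_inj (x y : admissible_seq x0) :
  (forall n, seq_of x n = seq_of y n) -> x = y.
Proof.
case: x y => [x xb] [y yb] /= xy.
have {}xy := functional_extensionality_dep xy; subst y.
by rewrite (Prop_irrelevance xb yb).
Qed.

Context (omega : set_system nat) (omegaU : UltraFilter omega).
Local Notation adm := (admissible_seq x0).
Local Notation cone := (cone x0 omegaU).

(** After division by [n] the additive error becomes [C / n], which tends to 0 because [omega]
    converges to infinity. *)
Lemma cone_mdist_le (x y x' y' : adm) (a C : R) :
  (forall m, omega <> principal_filter m) ->
  (forall n, mdist (seq_of x' n) (seq_of y' n) <=
    mdist (seq_of x n) (seq_of y n) + a * n%:R + C) ->
  mdist (\pi_cone x') (\pi_cone y') <= mdist (\pi_cone x) (\pi_cone y) + a.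
Proof.
move=> /(nonprincipal_ultra_cvg_infty omegaU) omega_oo le_xy.
rewrite !cone_mdistE.
have n_gt0 : \forall n \near omega, 0 < n%:R :> R.
  by apply: omega_oo; exists 1%N => // n /=; rewrite ltr0n.
have cC : (fun n => C / n%:R) @ omega --> C * 0.
  apply: cvgM; first exact: cvg_cst.
  apply/(gtr0_cvgV0 n_gt0).
  exact: cvg_trans (cvg_app _ omega_oo) cvgr_idn.
have cxy : scaled_dist x y @ omega --> lim (scaled_dist x y @ omega).
  exact: cvg_scaled_dist.
have cr : (fun n => scaled_dist x y n + a + C / n%:R) @ omega -->
    lim (scaled_dist x y @ omega) + a.
  rewrite -[_ + a]addr0 -[X in _ + X](mulr0 C).
  by apply: cvgD cC; apply: cvgD cxy _; exact: cvg_cst.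
rewrite -(cvg_lim _ cr)//; apply: ler_lim; first exact: cvg_scaled_dist.
  by apply/cvg_ex; eexists; exact: cr.
apply: filterS n_gt0 => n n_gt0.
(* Writing [a] as [a * n / n], valid for [n > 0], puts all terms over one denominator. *)
rewrite /scaled_dist/= -[X in _ <= _ + X + _](mulfK (lt0r_neq0 n_gt0)) -!mulrDl.
by rewrite ler_wpM2r// invr_ge0 ltW.
Qed.

End cone_estimates.

(** * Descending along the maps [p n] *)

Section descent.
Context (R : realType) (T : Type) (X : nat -> set T) (d : nat -> T -> T -> R).
Context (p : nat -> T -> T).

(** The descent stops at level 0, so [j] may exceed [n]; this matches the truncated [n - j] in
    [descendX]. *)
Fixpoint descend (n j : nat) (x : T) {struct j} : T :=
  match j, n with
  | j'.+1, n'.+1 => descend n' j' (p n x)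
  | _, _ => x
  end.

Lemma descend0 j x : descend 0 j x = x.
Proof. by case: j. Qed.

Context (dX : forall n, metric_on (X n) (d n)).
Context (subX : forall k n : nat, (k <= n)%N -> X k `<=` X n).
Context (restr_d : forall k n : nat, (k <= n)%N ->
  forall x y, X k x -> X k y -> d n x y = d k x y).
Context (pX : forall n x, X n.+1 x -> X n (p n.+1 x)).

Lemma descendX n j x : X n x -> X (n - j)%N (descend n j x).
Proof.
by elim: n j x => [|n IHn] [|j] x //= /pX; rewrite subSS; exact: IHn.
Qed.

Lemma descend_in n j x : X n x -> X n (descend n j x).
Proof. by move=> /(descendX j); exact: subX (leq_subr _ _) _. Qed.

Context (p_nonexp : forall n x y, X n.+1 x -> X n.+1 y ->
  d n (p n.+1 x) (p n.+1 y) <= d n.+1 x y).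

Lemma descend_nonexp n j x y : X n x -> X n y ->
  d n (descend n j x) (descend n j y) <= d n x y.
Proof.
elim: n j x y => [|n IHn] [|j] x y //= Xx Xy.
have [Xpx Xpy] := (pX Xx, pX Xy).
(* Both points now lie in [X n], so the distance can be measured one level lower, where the
   induction hypothesis applies. *)
rewrite (restr_d (leqnSn n)); [|exact: descend_in..].
exact: le_trans (IHn j _ _ Xpx Xpy) (p_nonexp Xx Xy).
Qed.

Context (K : R).
Context (K0 : 0 <= K).
Context (p_close : forall n x, X n.+1 x -> d n.+1 (p n.+1 x) x <= K).

(** Both points lie on the trajectory of [x], at most [j - i] steps of length at most [K] apart. The
    induction removes the common steps first, then adds up the others by the triangle inequality. *)
Lemma descend_dist n i j x : (i <= j)%N -> X n x ->
  d n (descend n i x) (descend n j x) <= K * (j%:R - i%:R).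
Proof.
elim: n i j x => [|n IHn] i j x ij Xx.
  (* At level 0 the descent is stationary even if [i < j]; the bound holds by [K0]. *)
  by rewrite !descend0 (metric_on_xx (dX 0))// mulr_ge0// subr_ge0 ler_nat//.
case: i j ij => [|i] [|j] //= ij.
- by rewrite (metric_on_xx (dX _))// subrr mulr0.
- have Xpx := pX Xx; have XSpx := subX (leqnSn n) Xpx.
  apply: le_trans (metric_on_triangle (dX n.+1) Xx XSpx _) _.
    exact: subX (leqnSn n) _ (descend_in _ _).
  rewrite (metric_on_sym (dX n.+1) Xx XSpx).
  rewrite (restr_d (leqnSn n) Xpx (descend_in j Xpx)).
  have -> : K * (j.+1%:R - 0) = K + K * (j%:R - 0) by rewrite -natr1; ring.
  by apply: lerD; [exact: p_close|exact: (IHn 0%N)].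
- have Xpx := pX Xx.
  rewrite (restr_d (leqnSn n)); [|exact: descend_in..].
  by rewrite -!natr1 (_ : _ - _ = j%:R - i%:R); [exact: IHn|ring].
Qed.

Lemma descend_dist_norm n i j x : X n x ->
  d n (descend n i x) (descend n j x) <= K * `|i%:R - j%:R|.
Proof.
move=> Xx; have [ij|/ltnW ji] := leqP i j.
  by rewrite distrC ger0_norm ?subr_ge0 ?ler_nat//; exact: descend_dist.
rewrite (metric_on_sym (dX n)); [|exact: descend_in..].
by rewrite ger0_norm ?subr_ge0 ?ler_nat//; exact: descend_dist.
Qed.

(** The intermediate point is [y] moved by the step count of [x]: equal step counts do not increase
    distances, and changing the count costs [K] per step. The final [K] pays for rounding. *)
Lemma descend_lipschitz n (s t : R) x y : X n x -> X n y ->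
  d n (descend n (Num.truncn (s * n%:R)) x)
    (descend n (Num.truncn (t * n%:R)) y) <=
    d n x y + K * `|s - t| * n%:R + K.
Proof.
move=> Xx Xy; set i := Num.truncn _; set j := Num.truncn _.
have Dx k : X n (descend n k x) by exact: descend_in.
have Dy k : X n (descend n k y) by exact: descend_in.
rewrite (le_trans (metric_on_triangle (dX n) (Dx i) (Dy i) (Dy j)))//.
rewrite -addrA lerD ?descend_nonexp//.
rewrite (le_trans (descend_dist_norm _ _ Xy))//.
rewrite -mulrA -[X in _ <= _ + X]mulr1 -mulrDr ler_wpM2l//.
rewrite (le_trans (distr_truncn_le _ _))//.
by rewrite -mulrBl normrM (ger0_norm (ler0n _ _)).
Qed.

Lemma descend_bottom n x x0 : X 0%N = [set x0] -> X n x -> descend n n x = x0.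
Proof. by move=> X0 /(descendX n); rewrite subnn X0. Qed.

Lemma dist_bottom n x x0 : X 0%N = [set x0] -> X n x -> d n x x0 <= K * n%:R.
Proof.
move=> X0 Xx; have := descend_dist (leq0n n) Xx.
by rewrite (descend_bottom X0 Xx) subr0.
Qed.

End descent.

(** * The contracting homotopy *)

Theorem lemma6p2 (R : realType) (T : Type)
  (X : nat -> set T) (d : nat -> T -> T -> R)
  (dX : forall n, metric_on (X n) (d n))
  (subX : forall k n : nat, (k <= n)%N -> X k `<=` X n)
  (restr_d : forall k n : nat, (k <= n)%N ->
    forall x y, X k x -> X k y -> d n x y = d k x y)
  (x0 : T) (X0 : X 0%N = [set x0])
  (p : nat -> T -> T)
  (pX : forall n x, X n.+1 x -> X n (p n.+1 x))
  (p_close : exists K : nat, forall n x, X n.+1 x ->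
    d n.+1 (p n.+1 x) x <= K%:R)
  (p_nonexp : forall n x y, X n.+1 x -> X n.+1 y ->
    d n (p n.+1 x) (p n.+1 y) <= d n.+1 x y)
  (omega : set_system nat) (omegaU : UltraFilter omega)
  (omega_nonprincipal : forall m : nat, omega <> principal_filter m) :
  contractible R
    (cone (X := fun n => metric_subspace (dX n))
      (fun n => subspace_pt (dX n) (nested_point subX X0 n)) omegaU).
Proof.
case: p_close => K pK.
pose adm := admissible_seq
  (fun n => subspace_pt (dX n) (nested_point subX X0 n)).
have all_bounded (u : forall n, metric_subspace (dX n)) : exists M : R,
    forall n, (0 < n)%N ->
      mdist (u n) (subspace_pt (dX n) (nested_point subX X0 n)) / n%:R <= M.
  exists K%:R => n n0; rewrite ler_pdivrMr ?ltr0n//.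
  exact: (dist_bottom dX subX restr_d pX _ pK X0 (subspace_valP _)).
pose h (t : R) (x : adm) : adm := AdmissibleSeq (all_bounded (fun n =>
  subspace_pt (dX n) (descend_in subX pX (Num.truncn (t * n%:R))
    (subspace_valP (seq_of x n))))).
(* [H] acts on the chosen representative of each class; [H_lipschitz] compares these
   representatives. *)
pose H (tc : R * cone (fun n => subspace_pt (dX n) (nested_point subX X0 n))
  omegaU) := \pi_(cone _ omegaU) (h tc.1 (repr tc.2)).
have H_lipschitz s t x y : mdist (H (s, x)) (H (t, y)) <=
    mdist x y + K%:R * `|s - t|.
  rewrite -{2}[x]reprK -{2}[y]reprK.
  apply: cone_mdist_le => // n.
  exact: (descend_lipschitz dX subX restr_d pX p_nonexp _ pK
    s t (subspace_valP _) (subspace_valP _)).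
exists (\pi_(cone _ omegaU) (AdmissibleSeq (all_bounded
  (fun n => subspace_pt (dX n) (nested_point subX X0 n))))).
exists H; split.
- apply: continuous_subspaceT => -[t x]; apply/cvg_ballP => e e0.
  have K1 : 0 < 2 * (K%:R + 1) :> R by rewrite mulr_gt0// ltr_wpDl.
  (* Time and point each contribute at most [e / 2]; [K + 1] keeps the radius defined when
     [K = 0]. *)
  exists (ball t (e / (2 * (K%:R + 1))), ball x (e / 2)).
    by split; apply: nbhsx_ballx; rewrite divr_gt0.
  move=> [s y] [/= ts]; rewrite !ballEmdist/= => xy.
  rewrite (le_lt_trans (H_lipschitz _ _ _ _))// [e]splitr ltr_leD//.
  move: ts; rewrite /ball/= ltr_pdivlMr// => ts.
  rewrite ler_pdivlMr// mulrC mulrA (le_trans _ (ltW ts))//.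
  by rewrite mulrC ler_wpM2l// ler_wpM2l// lerDl.
(* At time 0 no step is taken. *)
- move=> x; rewrite -[RHS]reprK /H; congr \pi; apply: seq_of_inj => n.
  apply: subspace_val_inj.
  by rewrite [LHS]/= mul0r truncn0.
(* At time 1 the [n]-th term takes exactly [n] steps and reaches [x0]. *)
- move=> x; rewrite /H; congr \pi; apply: seq_of_inj => n.
  apply: subspace_val_inj.
  rewrite [LHS]/= mul1r natrK.
  exact: (descend_bottom pX X0 (subspace_valP _)).
Qed.
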